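(* Let $\Delta$ and $\Delta'$ be two simplicial complexes with disjoint vertex sets. Let $\dim(\Delta')\leq\dim(\Delta)$, and put $n=\dim(\Delta)-\dim(\Delta')$ and $d=\dim(\Delta)$. Then $$h_k(\Delta\cup\Delta')=h_k(\Delta)+\sum_{p=0}^{n}(-1)^p\binom{n}{p}h_{k-p}(\Delta')-(-1)^k\binom{d+1}{k}$$ for all $0\leq k\leq d+1$.
   Context: A simplicial complex $\Delta$ on a finite vertex set is a family of subsets (faces) closed under taking subsets; $\dim F=|F|-1$ for a face $F$, and $\dim\Delta$ is the maximal dimension of a face. For $d=\dim\Delta$, let $f_i(\Delta)$ be the number of faces of dimension $i$ (so $f_{-1}(\Delta)=1$). The $h$-vector $h(\Delta)=(h_0,\dots,h_{d+1})$ is defined by $\sum_{i=0}^{d+1}h_it^i=\sum_{i=0}^{d+1}f_{i-1}t^i(1-t)^{d+1-i}$, equivalently $h_k(\Delta)=\sum_{i=0}^k(-1)^{k-i}\binom{d+1-i}{k-i}f_{i-1}(\Delta)$. By convention $h_k(\Delta)=0$ for $k<0$ and for $k>d+1$. For complexes with vertex sets $V,V'$, the union $\Delta\cup\Delta'$ is the complex on $V\cup V'$ whose faces are the sets that are faces of $\Delta$ or of $\Delta'$. *)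

(* Defs.v *)
From HB Require Import structures.
From mathcomp Require Import all_boot all_order all_algebra.
Set Implicit Arguments. Unset Strict Implicit. Unset Printing Implicit Defensive.
Import Order.TTheory GRing.Theory Num.Theory.
Local Open Scope ring_scope.

(* Not every vertex is required to be a face. The empty set is a face, in
   accordance with f_{-1} = 1; the complex {set0} has dimension -1. *)
Record complex (T : finType) := Complex {
  vertices : {set T};
  faces : {set {set T}};
  face_sub_vertices : forall F, F \in faces -> F \subset vertices;
  set0_face : set0 \in faces;
  face_closed : forall F G : {set T}, F \in faces -> G \subset F -> G \in faces
}.

Definition face_dim (T : finType) (F : {set T}) : int := #|F|%:Z - 1.

(* The default value -1 is the dimension of the empty face. *)
Definition complex_dim (T : finType) (D : complex T) : int :=
  \big[Num.max/-1]_(F in faces D) face_dim F.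

Definition f_vector (T : finType) (D : complex T) (i : int) : nat :=
  #|[set F in faces D | face_dim F == i]|.

(* complex_dim D + 1 as a natural number; the absolute value is harmless since
   -1 <= complex_dim D. *)
Definition dim1 (T : finType) (D : complex T) : nat := `|(complex_dim D + 1)%R|%N.

Lemma dim1E (T : finType) (D : complex T) : (dim1 D)%:Z = complex_dim D + 1.
Proof.
rewrite /dim1 gez0_abs // -lerBlDr sub0r /complex_dim.
elim/big_rec: _ => // F x _ hx.
by rewrite le_max hx orbT.
Qed.

Definition h_poly (T : finType) (D : complex T) : {poly int} :=
  \sum_(0 <= i < (dim1 D).+1)
    (f_vector D (i%:Z - 1))%:R *: ('X^i * (1 - 'X) ^+ (dim1 D - i)).

(* Vanishes for k > complex_dim D + 1 because h_poly D has degree at most complex_dim D + 1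
   (lemma h_vector_gt). *)
Definition h_vector (T : finType) (D : complex T) (k : int) : int :=
  match k with Posz m => (h_poly D)`_m | Negz _ => 0 end.

Lemma h_vectorE (T : finType) (D : complex T) (k : nat) :
  (k <= dim1 D)%N ->
  h_vector D k = \sum_(0 <= i < k.+1)
    (-1) ^+ (k - i) * ('C(dim1 D - i, k - i))%:R * (f_vector D (i%:Z - 1))%:R.
Proof.
have c1X n m : ((1 - 'X) ^+ n : {poly int})`_m = (-1) ^+ m * 'C(n, m)%:R.
  rewrite exprBn coef_sum.
  under eq_bigr => i _.
    rewrite coefMn expr1n mulr1 -(rmorphN1 polyC) -polyC_exp coefCM coefXn.
    over.
  have [mn|nm] := ltnP m n.+1.
    rewrite (bigD1 (Ordinal mn)) //= eqxx mulr1 big1 ?addr0 ?mulr_natr // => i ne.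
    by rewrite eq_sym (negPf (ne : i != m :> nat)) mulr0 mul0rn.
  rewrite bin_small // mulr0 big1 // => i _.
  by rewrite gtn_eqF ?mulr0 ?mul0rn // (leq_trans (ltn_ord i)).
move=> hk; rewrite /h_vector /h_poly coef_sum.
rewrite (@big_cat_nat _ _ _ k.+1) //=.
rewrite [X in _ + X]big_nat [X in _ + X]big1 ?addr0; last first.
  by move=> i /andP[ki _]; rewrite coefZ coefXnM ki mulr0.
apply: eq_big_nat => i /andP[_ ik].
by rewrite coefZ coefXnM ltnNge -ltnS ik /= c1X mulrC.
Qed.

Lemma h_vector_gt (T : finType) (D : complex T) (k : int) :
  complex_dim D + 1 < k -> h_vector D k = 0.
Proof.
rewrite -dim1E; case: k => // k; rewrite ltz_nat => hk.
rewrite /h_vector /h_poly coef_sum big_nat big1 // => i /andP[_ hi].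
rewrite coefZ nth_default ?mulr0 //; apply: leq_trans (size_polyMleq _ _) _.
rewrite size_polyXn addSn /=.
apply: leq_trans (_ : i + (dim1 D - i).+1 <= k)%N; last first.
  by rewrite addnS subnKC.
rewrite leq_add2l; apply: leq_trans (size_poly_exp_leq _ _) _.
have -> : size (1 - 'X : {poly int}) = 2.
  by rewrite -opprB size_polyN -[1]/(1%:P) size_XsubC.
by rewrite mul1n.
Qed.

Fact union_sub (T : finType) (D D' : complex T) (F : {set T}) :
  F \in faces D :|: faces D' -> F \subset vertices D :|: vertices D'.
Proof.
by case/setUP=> /face_sub_vertices /subset_trans; apply;
  rewrite (subsetUl, subsetUr).
Qed.

Fact union_set0 (T : finType) (D D' : complex T) :
  set0 \in faces D :|: faces D'.
Proof. by rewrite inE set0_face. Qed.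

Fact union_closed (T : finType) (D D' : complex T) (F G : {set T}) :
  F \in faces D :|: faces D' -> G \subset F -> G \in faces D :|: faces D'.
Proof.
by case/setUP=> + sGF; move=> /face_closed /(_ sGF); rewrite inE => ->;
  rewrite ?orbT.
Qed.

Definition complex_union (T : finType) (D D' : complex T) : complex T :=
  Complex (@union_sub T D D') (union_set0 D D') (@union_closed T D D').

(* Main.v *)
Require Import Defs.
From mathcomp Require Import all_boot all_order all_algebra.
Set Implicit Arguments. Unset Strict Implicit. Unset Printing Implicit Defensive.
Import Order.TTheory GRing.Theory Num.Theory.
Local Open Scope ring_scope.

(** Grouping by faces instead of by dimensions, the h-polynomial of a complex
    of dimension d is the sum over its faces F of X^#|F| (1 - X)^(d + 1 - #|F|)
    (lemma [h_poly_faces]). In this form the exponent of 1 - X is the only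
    trace of the dimension, and the face sum is additive up to the common faces.

    Complexes on disjoint vertex sets share exactly the empty face, which
    contributes (1 - X)^(d + 1). The union has the dimension d of the larger
    complex, so each face of the smaller one, of dimension d - n, acquires
    n further factors 1 - X. Hence (lemma [h_poly_union])
      h(D u D') = h(D) + (1 - X)^n h(D') - (1 - X)^(d + 1),
    and the theorem compares the coefficients of X^k, the binomial expansion of
    (1 - X)^n giving the alternating sum (lemma [coef_exp1subX_M]). *)

Lemma card_face_dim1 (T : finType) (D : complex T) (F : {set T}) :
  F \in faces D -> (#|F| <= dim1 D)%N.
Proof.
move=> DF; rewrite -lez_nat dim1E -lerBlDr.
exact: (le_bigmax_cond _ (fun G => face_dim G) DF).
Qed.

Lemma face_dim_eq (T : finType) (F : {set T}) (i : nat) :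
  (face_dim F == i%:Z - 1) = (#|F| == i).
Proof. by rewrite /face_dim subr_eq subrK. Qed.

Lemma h_poly_faces (T : finType) (D : complex T) :
  h_poly D = \sum_(F in faces D) 'X^#|F| * (1 - 'X) ^+ (dim1 D - #|F|).
Proof.
rewrite /h_poly big_mkord.
rewrite (partition_big (fun F : {set T} => inord #|F| : 'I_(dim1 D).+1) xpredT) //=.
apply: eq_bigr => i _.
rewrite (eq_bigl [in [set F in faces D | face_dim F == i%:Z - 1]]); last first.
  move=> F; rewrite !inE; case: (boolP (F \in faces D)) => //= DF.
  by rewrite face_dim_eq -val_eqE /= inordK // ltnS card_face_dim1.
under eq_bigr => F.
  rewrite /= inE face_dim_eq => /andP[_ /eqP ->].
  over.
by rewrite sumr_const -scaler_nat.
Qed.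

Lemma complex_dim_union (T : finType) (D D' : complex T) :
  complex_dim (complex_union D D') = Num.max (complex_dim D) (complex_dim D').
Proof. exact: bigmaxU. Qed.

Lemma faces_disjointI (T : finType) (D D' : complex T) :
  [disjoint vertices D & vertices D'] -> faces D :&: faces D' = [set set0].
Proof.
move=> hdisj; apply/setP=> F; rewrite !inE; apply/andP/eqP => [[DF D'F]|->].
  apply/eqP; rewrite -subset0 -(disjoint_setI0 hdisj) subsetI.
  by rewrite !face_sub_vertices.
by rewrite !set0_face.
Qed.

Lemma sumr_setU (I : finType) (V : zmodType) (A B : {set I}) (f : I -> V) :
  \sum_(i in A :|: B) f i =
    \sum_(i in A) f i + \sum_(i in B) f i - \sum_(i in A :&: B) f i.
Proof.
rewrite (big_setID A) setUK setDUl setDv set0U /=.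
by rewrite [\sum_(i in B) _](big_setID A) /= [B :&: A]setIC addrA addrAC addrK.
Qed.

(** The exponents of 1 - X attached to a face of [D'] in [D'] and in the union
    differ by the difference of the two dimensions. *)
Lemma h_poly_union (T : finType) (D D' : complex T) (n : nat) :
  [disjoint vertices D & vertices D'] ->
  n%:Z = complex_dim D - complex_dim D' ->
  h_poly (complex_union D D') =
    h_poly D + (1 - 'X) ^+ n * h_poly D' - (1 - 'X) ^+ dim1 D.
Proof.
move=> hdisj hn.
have hdim : complex_dim D' <= complex_dim D by rewrite -subr_ge0 -hn.
have dim1D : dim1 D = (n + dim1 D')%N.
  by apply/eqP; rewrite -eqz_nat PoszD !dim1E hn addrA subrK.
have dim1U : dim1 (complex_union D D') = dim1 D.
  by rewrite {1}/dim1 complex_dim_union max_l.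
rewrite !h_poly_faces dim1U sumr_setU faces_disjointI // big_set1 cards0.
rewrite expr0 mul1r subn0; congr (_ + _ - _).
rewrite mulr_sumr; apply: eq_bigr => F D'F.
by rewrite dim1D -addnBA ?card_face_dim1 // exprD mulrCA.
Qed.

Lemma coef_exp1subX_M (R : comNzRingType) (n k : nat) (q : {poly R}) :
  ((1 - 'X) ^+ n * q)`_k =
    \sum_(0 <= p < n.+1)
       (-1) ^+ p * 'C(n, p)%:R * (if (k < p)%N then 0 else q`_(k - p)).
Proof.
rewrite exprBn mulr_suml coef_sum big_mkord; apply: eq_bigr => p _.
rewrite expr1n mulr1 mulrnAl coefMn -(rmorphN1 polyC) -polyC_exp -[_ * q]mulrA coefCM.
by rewrite coefXnM mulr_natr mulrnAl.
Qed.

Theorem proposition1p4 (T : finType) (D D' : complex T)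
    (hdisj : [disjoint vertices D & vertices D'])
    (hdim : complex_dim D' <= complex_dim D)
    (n : nat) (hn : n%:Z = complex_dim D - complex_dim D')
    (k : nat) (hk : k%:Z <= complex_dim D + 1) :
  h_vector (complex_union D D') k%:Z =
    h_vector D k%:Z
    + \sum_(0 <= p < n.+1)
        (-1) ^+ p * ('C(n, p))%:R * h_vector D' (k%:Z - p%:Z)
    - (-1) ^+ k * ('C(dim1 D, k))%:R.
Proof.
rewrite /h_vector (h_poly_union hdisj hn) coefB coefD coef_exp1subX_M.
congr (_ + _ - _).
  apply: eq_bigr => p _; congr (_ * _).
  have [kp|pk] := ltnP k p; last by rewrite subzn.
  (* Writing p - k as a successor turns its opposite into a [Negz], where the
     h-vector is 0. *)
  by rewrite -opprB subzn ?(ltnW kp) // -(subnSK kp).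
move: hk; rewrite -dim1E lez_nat => hk.
(* The same expansion applied to the constant polynomial 1 gives the
   coefficients of (1 - X)^(d + 1). *)
rewrite -[_ ^+ dim1 D]mulr1 coef_exp1subX_M (bigD1_seq k) ?iota_uniq //=; last first.
  by rewrite mem_index_iota ltnS hk.
rewrite ltnn subnn coef1 mulr1 big1 ?addr0 // => p pk.
by case: ltnP => [|kp]; rewrite ?mulr0 // coef1 subn_eq0 leqNgt ltn_neqAle pk kp mulr0.
Qed.
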